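(* Let $q$ be an odd prime and let $E/\mathbb{Q}$ be an elliptic curve. Then every group in $\operatorname{Ent}_{2,q}(E/\mathbb{Q})$ is isomorphic to one of $1,\ \mathbb{Z}/2\mathbb{Z},\ \mathbb{Z}/3\mathbb{Z},\ S_3$. Furthermore, suppose that $T_{2,q}(E/\mathbb{Q})$ is trivial and that $\rho_{E,q}$ is surjective. Then, up to isomorphism, $$\operatorname{Ent}_{2,q}(E/\mathbb{Q})=\begin{cases}\{1,\mathbb{Z}/2\mathbb{Z},\mathbb{Z}/3\mathbb{Z}, S_3\}, &\text{if $\rho_{E,2}$ is surjective},\\ \{1,\mathbb{Z}/3\mathbb{Z}\}, &\text{if $\operatorname{im} \rho_{E,2}\cong \mathbb{Z}/3\mathbb{Z}$},\\ \{1,\mathbb{Z}/2\mathbb{Z}\}, &\text{if $\operatorname{im} \rho_{E,2}\cong \mathbb{Z}/2\mathbb{Z}$},\\ \{1\}, &\text{if $\rho_{E,2}$ is trivial.}\end{cases}$$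
   Context: All fields lie in a fixed algebraic closure $\bar{\mathbb{Q}}$. For an integer $n\ge 2$, $\rho_{E,n}:\operatorname{Gal}(\bar{\mathbb{Q}}/\mathbb{Q})\to \operatorname{GL}_2(\mathbb{Z}/n\mathbb{Z})$ is the mod $n$ Galois representation giving the action on $E[n]$; ''surjective'' means surjective onto $\operatorname{GL}_2(\mathbb{Z}/n\mathbb{Z})$. $L(E[n])$ denotes the $n$-torsion field of $E$ over $L$. For an algebraic extension $L/\mathbb{Q}$, $T_{2,q}(E/L)=\operatorname{Gal}\big(L(E[2])\cap L(E[q])/L\big)$, and $\operatorname{Ent}_{2,q}(E/\mathbb{Q})=\{T_{2,q}(E/L) : L/\mathbb{Q} \text{ algebraic}\}$, considered up to isomorphism. *)

(* Defs.v *)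
(* algC is the fixed algebraic closure of Q, so every subfield of
   algC is an algebraic extension of Q. *)
From HB Require Import structures.
From mathcomp Require Import all_boot all_order all_algebra all_fingroup.
From mathcomp Require Import all_field.
From mathcomp Require Import boolp.

Set Implicit Arguments.
Unset Strict Implicit.
Unset Printing Implicit Defensive.

Import GRing.Theory.
Local Open Scope ring_scope.

Definition group_iso (G H : groupType) : Prop :=
  exists2 f : G -> H, {morph f : x y / (x * y)%g} & bijective f.
Arguments group_iso (G H)%_type_scope.

Section SubfieldType.
Variable K : divringClosed algC.

Record subfield_of : predArgType :=
  Subfield {subfield_val : algC; _ : subfield_val \in K}.

HB.instance Definition _ := [isSub for subfield_val].
HB.instance Definition _ := [Choice of subfield_of by <:].
HB.instance Definition _ := [SubChoice_isSubIntegralDomain of subfield_of by <:].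
HB.instance Definition _ := [SubIntegralDomain_isSubField of subfield_of by <:].

End SubfieldType.

Section Gal.
Variables (F : fieldType) (k : {pred F}).

Definition is_fgal (s : F -> F) : Prop :=
  [/\ zmod_morphism s, monoid_morphism s, bijective s & {in k, s =1 id}].

(* Gal(F / k): the field automorphisms of F that fix k pointwise. *)
Record fgal : Type := MkFgal {fgal_fun :> F -> F; fgal_funP : is_fgal fgal_fun}.

Lemma fgal_eq (s t : fgal) : s =1 t -> s = t.
Proof.
case: s t => [s sP] [t tP] /= /funext eq_st; move: sP tP; rewrite eq_st => sP tP.
by congr MkFgal; apply: Prop_irrelevance.
Qed.

HB.instance Definition _ := gen_eqMixin fgal.
HB.instance Definition _ := gen_choiceMixin fgal.

HB.instance Definition _ (s : fgal) :=
  GRing.isZmodMorphism.Build F F s (let: And4 sB _ _ _ := fgal_funP s in sB).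
HB.instance Definition _ (s : fgal) :=
  GRing.isMonoidMorphism.Build F F s (let: And4 _ sM _ _ := fgal_funP s in sM).

Lemma fgal_bij (s : fgal) : bijective s. Proof. by case: (fgal_funP s). Qed.
Lemma fgal_fix (s : fgal) : {in k, s =1 id}. Proof. by case: (fgal_funP s). Qed.

Lemma fgal_one_subproof : is_fgal id.
Proof. by split=> //; exists id. Qed.
Definition fgal_one := MkFgal fgal_one_subproof.

Lemma fgal_mul_subproof (s t : fgal) : is_fgal (s \o t).
Proof.
split; first by move=> x y /=; rewrite !rmorphB.
- by split=> [|x y] /=; rewrite ?rmorph1 ?rmorphM.
- by apply: bij_comp; apply: fgal_bij.
- by move=> x kx /=; rewrite !fgal_fix.
Qed.
Definition fgal_mul s t := MkFgal (fgal_mul_subproof s t).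

Lemma fgal_surj (s : fgal) y : exists x, s x == y.
Proof. by case: (fgal_bij s) => t _ tK; exists (t y); rewrite tK. Qed.

Definition fgal_inv_fun (s : fgal) y := xchoose (fgal_surj s y).

Lemma fgal_invKV (s : fgal) : cancel (fgal_inv_fun s) s.
Proof. by move=> y; apply/eqP/(xchooseP (fgal_surj s y)). Qed.

Lemma fgal_invK (s : fgal) : cancel s (fgal_inv_fun s).
Proof. by move=> x; apply: (bij_inj (fgal_bij s)); rewrite fgal_invKV. Qed.

Lemma fgal_inv_subproof (s : fgal) : is_fgal (fgal_inv_fun s).
Proof.
split; first exact: can2_zmod_morphism (fgal_invK s) (fgal_invKV s).
- exact: can2_monoid_morphism (fgal_invK s) (fgal_invKV s).
- by exists s; [apply: fgal_invKV | apply: fgal_invK].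
- by move=> x kx /=; rewrite -{1}(fgal_fix s kx) fgal_invK.
Qed.
Definition fgal_inv s := MkFgal (fgal_inv_subproof s).

Lemma fgal_mulA : associative fgal_mul. Proof. by move=> r s t; apply: fgal_eq. Qed.
Lemma fgal_mul1g : left_id fgal_one fgal_mul. Proof. by move=> s; apply: fgal_eq. Qed.
Lemma fgal_mulg1 : right_id fgal_one fgal_mul. Proof. by move=> s; apply: fgal_eq. Qed.
Lemma fgal_mulVg : left_inverse fgal_one fgal_inv fgal_mul.
Proof. by move=> s; apply: fgal_eq => x /=; rewrite fgal_invK. Qed.
Lemma fgal_mulgV : right_inverse fgal_one fgal_inv fgal_mul.
Proof. by move=> s; apply: fgal_eq => x /=; rewrite fgal_invKV. Qed.

HB.instance Definition _ :=
  isGroup.Build fgal fgal_mulA fgal_mul1g fgal_mulg1 fgal_mulVg fgal_mulgV.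

End Gal.

(* Gal(K / L) for subfields L, K of algC with L contained in K. *)
Definition relGal (K L : divringClosed algC) : groupType :=
  fgal [pred x : subfield_of K | val x \in L].

Section Subfields.

Definition adjoin (L : divringClosed algC) (S : algC -> Prop) : {pred algC} :=
  fun x => `[< forall M : divringClosed algC,
    {subset L <= M} -> (forall z, S z -> z \in M) -> x \in M >].

Lemma adjoin_divring L S : divring_closed (adjoin L S).
Proof.
split=> [|x y /asboolP Sx /asboolP Sy|x y /asboolP Sx /asboolP Sy].
- by apply/asboolP => M _ _; apply: rpred1.
- by apply/asboolP => M LM SM; rewrite rpredB ?Sx ?Sy.
- by apply/asboolP => M LM SM; rewrite rpred_div ?Sx ?Sy.
Qed.
HB.instance Definition _ L S :=
  GRing.isDivringClosed.Build algC (adjoin L S) (adjoin_divring L S).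

Definition capfield (K1 K2 : divringClosed algC) : {pred algC} :=
  fun x => (x \in K1) && (x \in K2).

Lemma capfield_divring K1 K2 : divring_closed (capfield K1 K2).
Proof.
split=> [|x y /andP[x1 x2] /andP[y1 y2]|x y /andP[x1 x2] /andP[y1 y2]].
- by apply/andP; rewrite !rpred1.
- by apply/andP; rewrite !rpredB.
- by apply/andP; rewrite !rpred_div.
Qed.
HB.instance Definition _ K1 K2 :=
  GRing.isDivringClosed.Build algC (capfield K1 K2) (capfield_divring K1 K2).

End Subfields.

(* y^2 + a1 x y + a3 y = x^3 + a2 x^2 + a4 x + a6 over Q; ec_disc is the usual
   discriminant -b2^2 b8 - 8 b4^3 - 27 b6^2 + 9 b2 b4 b6. *)
Definition ec_disc (a1 a2 a3 a4 a6 : rat) : rat :=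
  let b2 := a1 ^+ 2 + 4 * a2 in
  let b4 := 2 * a4 + a1 * a3 in
  let b6 := a3 ^+ 2 + 4 * a6 in
  let b8 := a1 ^+ 2 * a6 + 4 * a2 * a6 - a1 * a3 * a4 + a2 * a3 ^+ 2 - a4 ^+ 2 in
  - b2 ^+ 2 * b8 - 8 * b4 ^+ 3 - 27 * b6 ^+ 2 + 9 * b2 * b4 * b6.

Record elliptic_curve := EllipticCurve {
  ec_a1 : rat; ec_a2 : rat; ec_a3 : rat; ec_a4 : rat; ec_a6 : rat;
  _ : ec_disc ec_a1 ec_a2 ec_a3 ec_a4 ec_a6 != 0
}.

Inductive point := Inf | Aff of algC & algC.

Definition point_to_opt P := if P is Aff x y then Some (x, y) else None.
Definition opt_to_point o := if o is Some (x, y) then Aff x y else Inf.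
Lemma point_to_optK : cancel point_to_opt opt_to_point. Proof. by case. Qed.
HB.instance Definition _ := Equality.copy point (can_type point_to_optK).

Section EllipticCurve.
Variable E : elliptic_curve.

Let a1 : algC := ratr (ec_a1 E).
Let a2 : algC := ratr (ec_a2 E).
Let a3 : algC := ratr (ec_a3 E).
Let a4 : algC := ratr (ec_a4 E).
Let a6 : algC := ratr (ec_a6 E).

Definition oncurve (P : point) : bool :=
  if P is Aff x y then
    y ^+ 2 + a1 * x * y + a3 * y == x ^+ 3 + a2 * x ^+ 2 + a4 * x + a6
  else true.

(* The chord-tangent law: y = l x + nu is the line through P and Q (the tangent
   when P = Q); the sum is infinity when Q = - P. *)
Definition ec_add (P Q : point) : point :=
  match P, Q with
  | Inf, _ => Q
  | _, Inf => P
  | Aff x1 y1, Aff x2 y2 =>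
    if (x1 == x2) && (y1 + y2 + a1 * x2 + a3 == 0) then Inf else
    let l := if x1 == x2
      then (3 * x1 ^+ 2 + 2 * a2 * x1 + a4 - a1 * y1) / (2 * y1 + a1 * x1 + a3)
      else (y2 - y1) / (x2 - x1) in
    let nu := y1 - l * x1 in
    let x3 := l ^+ 2 + a1 * l - a2 - x1 - x2 in
    Aff x3 (- (l + a1) * x3 - nu - a3)
  end.

Definition ec_mul (n : nat) (P : point) : point := iter n (ec_add P) Inf.

Definition ec_torsion (n : nat) (P : point) : bool :=
  oncurve P && (ec_mul n P == Inf).

Definition torsion_coord (n : nat) (z : algC) : Prop :=
  exists x y, ec_torsion n (Aff x y) /\ (z = x \/ z = y).

Definition torsion_field (L : divringClosed algC) (n : nat) : divringClosed algC :=
  adjoin L (torsion_coord n).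

(* T_{m,n}(E/L) = Gal(L(E[m]) cap L(E[n]) / L) *)
Definition entanglement (m n : nat) (L : divringClosed algC) : groupType :=
  relGal (capfield (torsion_field L m) (torsion_field L n)) L.

(* Ent_{m,n}(E/Q), as an isomorphism-closed class of groups. *)
Definition Ent (m n : nat) (G : groupType) : Prop :=
  exists L : divringClosed algC, group_iso G (entanglement m n L).

(* fgal Crat is Gal(Qbar / Q). *)
Definition ec_act (s : fgal Crat) (P : point) : point :=
  if P is Aff x y then Aff (s x) (s y) else Inf.

Lemma oncurve_act s P : oncurve (ec_act s P) = oncurve P.
Proof.
case: P => [|x y] //=; rewrite /a1 /a2 /a3 /a4 /a6 -[in RHS](fmorph_eq s).
by rewrite !(fmorph_rat s, rmorphXn s, rmorphD s, rmorphM s).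
Qed.

Lemma ec_act_add s P Q : ec_act s (ec_add P Q) = ec_add (ec_act s P) (ec_act s Q).
Proof.
have sE := (fmorph_rat s, rmorphXn s, fmorphV s, rmorph_nat s, rmorphD s,
            rmorphN s, rmorphM s).
rewrite /ec_add /a1 /a2 /a3 /a4 /a6.
case: P Q => [|x1 y1] [|x2 y2] //=; rewrite fmorph_eq.
have -> : (s y1 + s y2 + ratr (ec_a1 E) * s x2 + ratr (ec_a3 E) == 0)
  = (y1 + y2 + ratr (ec_a1 E) * x2 + ratr (ec_a3 E) == 0).
  by rewrite -[in RHS](fmorph_eq0 s) !sE.
by case: ifP => // _; case: ifP => _ /=; rewrite !sE.
Qed.

Lemma ec_act_torsion s n P : ec_torsion n P -> ec_torsion n (ec_act s P).
Proof.
case/andP=> cP /eqP nP; rewrite /ec_torsion oncurve_act cP /=; apply/eqP.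
have mulE m : ec_mul m (ec_act s P) = ec_act s (ec_mul m P).
  by elim: m => //= m IHm; rewrite ec_act_add -IHm.
by rewrite mulE nP.
Qed.

Lemma ec_act1 P : ec_act 1%g P = P. Proof. by case: P. Qed.
Lemma ec_actM s t P : ec_act (s * t)%g P = ec_act s (ec_act t P).
Proof. by case: P. Qed.

(* A choice of basis of E[n], i.e. a group isomorphism (Z/n)^2 -> E[n]. *)
Record torsion_basis (n : nat) := TorsionBasis {
  tb_fun :> 'cV['Z_n]_2 -> point;
  tb_add : forall u v, tb_fun (u + v) = ec_add (tb_fun u) (tb_fun v);
  tb_inj : injective tb_fun;
  tb_img : forall P, ec_torsion n P <-> exists v, tb_fun v = P
}.

Section Rho.
Variables (n : nat) (B : torsion_basis n).

Definition tb_coord (P : point) : 'cV['Z_n]_2 := odflt 0 [pick v | B v == P].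

Lemma tb_coordK P : ec_torsion n P -> B (tb_coord P) = P.
Proof.
move=> /(tb_img B)[v vP]; rewrite /tb_coord; case: pickP => [w /eqP //|/(_ v)].
by rewrite vP eqxx.
Qed.

Definition rho_mx (s : fgal Crat) : 'M['Z_n]_2 :=
  \matrix_(i, j) tb_coord (ec_act s (B (delta_mx j 0))) i 0.

Lemma rho_mxP s v : B (rho_mx s *m v) = ec_act s (B v).
Proof.
have torB u : ec_torsion n (B u) by apply/(tb_img B); exists u.
pose f u := tb_coord (ec_act s (B u)).
have fP u : B (f u) = ec_act s (B u) by rewrite tb_coordK // ec_act_torsion.
have fD : {morph f : u w / u + w}.
  by move=> u w; apply: (@tb_inj _ B); rewrite tb_add !fP tb_add ec_act_add.
have f0 : f 0 = 0 by apply: (addIr (f 0)); rewrite -fD !add0r.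
have fMn m u : f (u *+ m) = f u *+ m.
  by elim: m => [|m IHm]; rewrite ?mulr0n // !mulrS fD IHm.
have fZ c u : f (c *: u) = c *: f u by rewrite -[c]natr_Zp !scaler_nat fMn.
rewrite -fP; congr (B _).
have [-> ] : v = \sum_j v j 0 *: delta_mx j 0 /\ True.
  split=> //; rewrite {1}[v]matrix_sum_delta; apply: eq_bigr => j _.
  by rewrite big_ord1.
move=> _; rewrite (big_morph f fD f0) mulmx_sumr; apply: eq_bigr => j _.
rewrite fZ -scalemxAr -colE; congr (_ *: _).
by apply/matrixP => i k; rewrite !mxE ord1.
Qed.

Lemma mulcV_inj (A C : 'M['Z_n]_2) : (forall v : 'cV_2, A *m v = C *m v) -> A = C.
Proof.
move=> eqAC; apply/matrixP => i j.
by have := eqAC (delta_mx j 0); rewrite -!colE => /matrixP/(_ i 0); rewrite !mxE.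
Qed.

Lemma rho_mx1 : rho_mx 1%g = 1%:M.
Proof.
by apply: mulcV_inj => v; apply: (@tb_inj _ B); rewrite rho_mxP ec_act1 mul1mx.
Qed.

Lemma rho_mxM s t : rho_mx (s * t)%g = rho_mx s *m rho_mx t.
Proof.
apply: mulcV_inj => v; apply: (@tb_inj _ B).
by rewrite rho_mxP -mulmxA !rho_mxP ec_actM.
Qed.

Lemma rho_mx_unit s : rho_mx s \is a GRing.unit.
Proof.
have rV : rho_mx s *m rho_mx s^-1%g = 1%:M by rewrite -rho_mxM mulgV rho_mx1.
by have [] := mulmx1_unit rV.
Qed.

Definition rho (s : fgal Crat) : {'GL_2['Z_n]} := FinRing.Unit (rho_mx_unit s).

Lemma rhoM : {morph rho : s t / (s * t)%g}.
Proof. by move=> s t; apply: val_inj; apply: rho_mxM. Qed.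

Definition rho_img : {set {'GL_2['Z_n]}} := [set g | `[< exists s, rho s = g >]].

Lemma rho_img_group_set : group_set rho_img.
Proof.
apply/group_setP; split=> [|_ _ /[!inE] /asboolP[s <-] /asboolP[t <-]].
  by rewrite inE; apply/asboolP; exists 1%g; apply: val_inj; apply: rho_mx1.
by apply/asboolP; exists (s * t)%g; rewrite rhoM.
Qed.
Canonical rho_img_group := Group rho_img_group_set.

End Rho.

End EllipticCurve.

(* Main.v *)
(* Every automorphism of a subfield of algC extends to algC, so T_{2,q}(E/L) is
   a quotient of the group of permutations of the x-coordinates of the 2-torsion
   points induced by Gal(algC/L), a subgroup of S_3.  Conversely, suppose that
   T_{2,q}(E/Q) is trivial and rho_q surjective.  By Goursat's lemma the image
   of (rho_2, rho_q) is the full product im rho_2 x GL_2(Z/q).  As GL_2(Z/2)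
   lifts to GL_2(Z), it embeds in GL_2(Z/q); for A <= im rho_2, the 2-torsion
   and q-torsion fields over the fixed field of the preimage of the graph of
   this embedding on A coincide and have Galois group A. *)
Require Import Defs.
From HB Require Import structures.
From mathcomp Require Import all_boot all_order all_algebra all_fingroup.
From mathcomp Require Import all_field.
From mathcomp Require Import cyclic pgroup ring.
From mathcomp Require Import boolp.

Set Implicit Arguments.
Unset Strict Implicit.
Unset Printing Implicit Defensive.

Import GRing.Theory.
Local Open Scope ring_scope.

(** * Embeddings of subfields of the algebraic closure *)

Section MinimalPolynomial.
Variables (F L : fieldType) (iota : {rmorphism F -> L}).
Implicit Types (x : L) (p f : {poly F}).

Definition minimal_poly x p :=
  [/\ p != 0, root (map_poly iota p) x
    & forall f, root (map_poly iota f) x -> p %| f].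

Lemma minimal_poly_exists x :
  algebraicOver iota x -> exists p, minimal_poly x p.
Proof.
case=> p0 nz_p0 p0x.
pose annihilated n := `[< exists p,
  [/\ p != 0, root (map_poly iota p) x & size p = n] >].
have exists_annihilated : exists n, annihilated n.
  by exists (size p0); apply/asboolP; exists p0.
case: (ex_minnP exists_annihilated) => _ /asboolP[p [nz_p px <-]] min_p.
exists p; split=> // f fx; apply/eqP; rewrite -/(dvdp p f).
apply: contraTeq (ltn_modpN0 f nz_p) => nz_r; rewrite -leqNgt.
apply: min_p; apply/asboolP; exists (f %% p); split=> //.
move: fx; rewrite {1}(divp_eq f p) rmorphD rmorphM /root !hornerE.
by rewrite (rootP px) mulr0 add0r.
Qed.

Lemma minimal_poly_irreducible x p : minimal_poly x p -> irreducible_poly p.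
Proof.
case=> nz_p px min_p; split=> [|d d_neq1 d_dvd_p].
  rewrite -(size_map_poly iota); apply: root_size_gt1 px.
  by rewrite map_poly_eq0.
apply/andP; split=> //; have /dvdpP[h Dp] := d_dvd_p.
have /norP[nz_h nz_d] : ~~ ((h == 0) || (d == 0)) by rewrite -mulf_eq0 -Dp.
have: root (map_poly iota (h * d)) x by rewrite -Dp.
rewrite rmorphM rootM => /orP[/min_p/(dvdp_leq nz_h)|/min_p //].
rewrite Dp size_mul // => h_d_le_h; case/negP: d_neq1.
by move: h_d_le_h nz_d; rewrite -size_poly_eq0; case: (size d) => [|[|d']] //;
  rewrite !addnS /= ltnNge leq_addr.
Qed.

Lemma minimal_poly_size_map (L' : fieldType) (iota' : {rmorphism F -> L'}) x p :
  minimal_poly x p -> size (map_poly iota' p) != 1%N.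
Proof.
by move/minimal_poly_irreducible=> [p_gt1 _]; rewrite size_map_poly gtn_eqF.
Qed.

Lemma minimal_poly_inv x p f : minimal_poly x p ->
  exists h, (map_poly iota f).[x]^-1 = (map_poly iota h).[x].
Proof.
move=> p_min; have [_ px min_p] := p_min.
have [fx0|nz_fx] := eqVneq (map_poly iota f).[x] 0.
  by exists 0; rewrite fx0 invr0 rmorph0 hornerE.
have: coprimep p f.
  rewrite (irreducible_poly_coprime _ (minimal_poly_irreducible p_min)).
  apply: contraNN nz_fx => /dvdpP[k ->].
  by rewrite rmorphM hornerM (rootP px) mulr0.
case/Bezout_eq1_coprimepP=> -[u v] /= bezout; exists v.
apply: (mulIf nz_fx); rewrite mulVf //.
have := congr1 (fun g => (map_poly iota g).[x]) bezout.
by rewrite rmorphD !rmorphM rmorph1 !hornerE (rootP px) mulr0 add0r.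
Qed.

End MinimalPolynomial.

Section SimpleExtension.
Variables (K : divringClosed algC) (x : algC).
Implicit Types f p : {poly subfield_of K}.

Lemma subfield_minimal_poly :
  exists p : {poly subfield_of K}, minimal_poly val x p.
Proof.
have [m [_ mon_m] m_dvd] := minCpolyP x; apply: minimal_poly_exists.
pose m_K : {poly subfield_of K} := map_poly ratr m.
have Dm_K : map_poly val m_K = map_poly ratr m.
  by rewrite -map_poly_comp; apply: eq_map_poly => a; apply: fmorph_rat.
exists m_K; last by rewrite Dm_K m_dvd dvdpp.
rewrite -(map_poly_eq0 val) Dm_K map_poly_eq0; exact: monic_neq0.
Qed.

Definition simple_ext : {pred algC} :=
  fun z => `[< exists f : {poly subfield_of K}, z = (map_poly val f).[x] >].

Lemma simple_ext_divring : divring_closed simple_ext.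
Proof.
split=> [|_ _ /asboolP[f ->] /asboolP[g ->]|_ _ /asboolP[f ->] /asboolP[g ->]].
- by apply/asboolP; exists 1; rewrite rmorph1 hornerE.
- by apply/asboolP; exists (f - g); rewrite rmorphB !hornerE.
- have [p /(minimal_poly_inv g)[h ->]] := subfield_minimal_poly.
  by apply/asboolP; exists (f * h); rewrite rmorphM hornerM.
Qed.
HB.instance Definition _ :=
  GRing.isDivringClosed.Build algC simple_ext simple_ext_divring.

Lemma sub_simple_ext : {subset K <= simple_ext}.
Proof.
move=> z Kz; apply/asboolP; exists (Subfield Kz)%:P.
by rewrite map_polyC hornerC.
Qed.

Lemma simple_ext_gen : x \in simple_ext.
Proof. by apply/asboolP; exists 'X; rewrite map_polyX hornerX. Qed.

Lemma simple_ext_repr (u : subfield_of simple_ext) :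
  {f : {poly subfield_of K} | val u = (map_poly val f).[x]}.
Proof. by apply: cid; apply/asboolP; apply: valP u. Qed.

Section ExtendMorphism.
Variables (t : {rmorphism subfield_of K -> algC}) (y : algC).
Variable p : {poly subfield_of K}.
Hypotheses (p_min : minimal_poly val x p) (py : root (map_poly t p) y).

Definition simple_ext_fun u := (map_poly t (sval (simple_ext_repr u))).[y].

Lemma simple_ext_funE u f :
  val u = (map_poly val f).[x] -> simple_ext_fun u = (map_poly t f).[y].
Proof.
rewrite /simple_ext_fun; case: simple_ext_repr => g /= -> gf.
have [_ _ min_p] := p_min.
have /min_p/dvdpP[h /eqP] : root (map_poly val (g - f)) x.
  by rewrite rmorphB /root !hornerE gf subrr.
rewrite subr_eq => /eqP ->.
by rewrite rmorphD rmorphM !hornerE (rootP py) mulr0 add0r.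
Qed.

Lemma simple_ext_fun_zmod : zmod_morphism simple_ext_fun.
Proof.
move=> u v; have [[f Df] [g Dg]] := (simple_ext_repr u, simple_ext_repr v).
rewrite (simple_ext_funE Df) (simple_ext_funE Dg).
by rewrite (@simple_ext_funE _ (f - g)) ?rmorphB ?hornerE //= Df Dg.
Qed.

Lemma simple_ext_fun_monoid : monoid_morphism simple_ext_fun.
Proof.
split=> [|u v]; first by rewrite (@simple_ext_funE _ 1) ?rmorph1 ?hornerE.
have [[f Df] [g Dg]] := (simple_ext_repr u, simple_ext_repr v).
rewrite (simple_ext_funE Df) (simple_ext_funE Dg).
by rewrite (@simple_ext_funE _ (f * g)) ?rmorphM ?hornerE //= Df Dg.
Qed.

HB.instance Definition _ :=
  GRing.isZmodMorphism.Build _ _ simple_ext_fun simple_ext_fun_zmod.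
HB.instance Definition _ :=
  GRing.isMonoidMorphism.Build _ _ simple_ext_fun simple_ext_fun_monoid.

Definition simple_ext_morphism : {rmorphism subfield_of simple_ext -> algC} :=
  simple_ext_fun.

Lemma simple_ext_morphism_base
    (u : subfield_of K) (v : subfield_of simple_ext) :
  val u = val v -> t u = simple_ext_morphism v.
Proof.
move=> Duv; apply: esym; apply: etrans (@simple_ext_funE _ u%:P _) _;
  by rewrite map_polyC hornerC.
Qed.

Lemma simple_ext_morphism_gen :
  simple_ext_morphism (Subfield simple_ext_gen) = y.
Proof.
by apply: etrans (@simple_ext_funE _ 'X _) _; rewrite map_polyX hornerX.
Qed.

End ExtendMorphism.

End SimpleExtension.

Record embedding := Embedding {
  emb_dom : divringClosed algC;
  emb_fun :> {rmorphism subfield_of emb_dom -> algC} }.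

Definition extends (e e' : embedding) :=
  {subset emb_dom e <= emb_dom e'}
    /\ forall u u', val u = val u' -> e u = e' u'.

Lemma extends_refl e : extends e e.
Proof. by split=> // u v /val_inj->. Qed.

Lemma extends_trans e2 e1 e3 : extends e1 e2 -> extends e2 e3 -> extends e1 e3.
Proof.
move=> [dom12 eq12] [dom23 eq23]; split=> [z /dom12/dom23 //|u v Duv].
have u2 : val u \in emb_dom e2 by apply/dom12/valP.
by rewrite (eq12 u (Subfield u2)) //; apply: eq23.
Qed.

Lemma embedding_extend_root (e : embedding) (x y : algC) p :
    minimal_poly val x p -> root (map_poly e p) y ->
  exists2 e', extends e e'
    & exists2 u : subfield_of (emb_dom e'), val u = x & e' u = y.
Proof.
move=> p_min py; exists (Embedding (simple_ext_morphism p_min py)).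
  split; [exact: sub_simple_ext | exact: simple_ext_morphism_base].
exists (Subfield (simple_ext_gen (emb_dom e) x)); first by [].
exact: simple_ext_morphism_gen.
Qed.

Lemma embedding_extend (e : embedding) (x : algC) :
  exists e', extends e e' /\ x \in emb_dom e'.
Proof.
have [p p_min] := subfield_minimal_poly (emb_dom e) x.
have /closed_rootP[y py] := minimal_poly_size_map e p_min.
have [e' ee' [u <- _]] := embedding_extend_root p_min py.
by exists e'; split; last exact: valP.
Qed.

Lemma algC_endo_is_fgal (s : {rmorphism algC -> algC}) : is_fgal Crat s.
Proof.
split; [exact: raddfB | exact: rmorphism_monoidP | | by move=> x /(aut_Crat s)].
by exists (algC_invaut s); [apply: algC_autK | apply: algC_invautK].
Qed.

Section DirectedUnion.
Variable e : nat -> embedding.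
Hypothesis e_mono : {homo e : m n / (m <= n)%N >-> extends m n}.
Hypothesis e_exhaustive : forall x, exists n, x \in emb_dom (e n).

Definition union_fun (x : algC) : algC :=
  let (n, en_x) := cid (e_exhaustive x) in e n (Subfield en_x).

Lemma union_funE n (u : subfield_of (emb_dom (e n))) :
  union_fun (val u) = e n u.
Proof.
rewrite /union_fun; case: cid => m em_u.
have [mn|/ltnW nm] := leqP m n; first exact: (e_mono mn).2.
by apply/esym/(e_mono nm).2.
Qed.

Lemma union_common_dom x y :
  exists n, (x \in emb_dom (e n)) && (y \in emb_dom (e n)).
Proof.
have [[m em_x] [n en_y]] := (e_exhaustive x, e_exhaustive y).
exists (maxn m n); rewrite (e_mono (leq_maxl m n)).1 //.
by rewrite (e_mono (leq_maxr m n)).1.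
Qed.

Lemma union_fun_zmod : zmod_morphism union_fun.
Proof.
move=> x y; have [n /andP[xn yn]] := union_common_dom x y.
rewrite -[x]/(val (Subfield xn)) -[y]/(val (Subfield yn)) -rmorphB.
by rewrite !union_funE rmorphB.
Qed.

Lemma union_fun_monoid : monoid_morphism union_fun.
Proof.
split=> [|x y].
  by rewrite -[1]/(val (1 : subfield_of (emb_dom (e 0)))) union_funE rmorph1.
have [n /andP[xn yn]] := union_common_dom x y.
rewrite -[x]/(val (Subfield xn)) -[y]/(val (Subfield yn)) -rmorphM.
by rewrite !union_funE rmorphM.
Qed.

HB.instance Definition _ :=
  GRing.isZmodMorphism.Build _ _ union_fun union_fun_zmod.
HB.instance Definition _ :=
  GRing.isMonoidMorphism.Build _ _ union_fun union_fun_monoid.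

Lemma embedding_union :
  exists s : fgal Crat,
    forall n (u : subfield_of (emb_dom (e n))), s (val u) = e n u.
Proof. by exists (MkFgal (algC_endo_is_fgal union_fun)); apply: union_funE. Qed.

End DirectedUnion.

(* The closure is countable, so adjoining its elements one at a time
   exhausts it. *)
Lemma embedding_extend_fgal (e0 : embedding) :
  exists s : fgal Crat, forall u, s (val u) = e0 u.
Proof.
have [next nextP] :=
  choice (fun ex : embedding * algC => embedding_extend ex.1 ex.2).
pose e := fix e n := if n is m.+1
  then next (e m, odflt 0 (unpickle m)) else e0.
have e_mono : {homo e : m n / (m <= n)%N >-> extends m n}.
  apply: homo_leq => [||n]; [exact: extends_refl | exact: extends_trans |].
  exact: (nextP (e n, _)).1.
have e_exhaustive x : exists n, x \in emb_dom (e n).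
  exists (pickle x).+1.
  by have := (nextP (e (pickle x), x)).2; rewrite /= pickleK.
have [s sE] := embedding_union e_mono e_exhaustive.
by exists s; apply: (sE 0%N).
Qed.

(** * Galois theory of the algebraic closure *)

Section FixedFields.
Implicit Types (K L : divringClosed algC) (s t : fgal Crat) (S : {pred algC}).

Definition fixes S s := {in S, s =1 id}.

Definition fixes_all (T : algC -> Prop) s := forall z, T z -> s z = z.

Definition gal_stable (T : algC -> Prop) :=
  forall (s : fgal Crat) z, T z -> T (s z).

Definition stable_over L S := forall s, fixes L s -> {homo s : x / x \in S}.

Lemma fgalK s : cancel s (s^-1)%g.
Proof. exact: fgal_invK. Qed.

Lemma fgalVK s : cancel (s^-1)%g s.
Proof. exact: fgal_invKV. Qed.

Lemma fixesM S s t : fixes S s -> fixes S t -> fixes S (s * t)%g.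
Proof.
by move=> fix_s fix_t x Sx /=; rewrite -[RHS](fix_s x Sx) -[in RHS](fix_t x Sx).
Qed.

Lemma fixesV S s : fixes S s -> fixes S (s^-1)%g.
Proof. by move=> fix_s x Sx; rewrite -{1}(fix_s x Sx) fgalK. Qed.

Lemma fixes_Crat s : fixes Crat s.
Proof. exact: fgal_fix. Qed.

Definition fixfield (P : fgal Crat -> Prop) : {pred algC} :=
  fun x => `[< forall s, P s -> s x = x >].

Lemma fixfield_divring P : divring_closed (fixfield P).
Proof.
split=> [|x y /asboolP Px /asboolP Py|x y /asboolP Px /asboolP Py];
  apply/asboolP => s Ps; first exact: rmorph1.
- by rewrite rmorphB /= Px ?Py.
- by rewrite rmorphM fmorphV /= Px ?Py.
Qed.
HB.instance Definition _ P :=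
  GRing.isDivringClosed.Build algC (fixfield P) (fixfield_divring P).

(* In characteristic 0 the sum of the roots, which is a coefficient of [p] up to
   a factor in [K], is a nonzero multiple of the root. *)
Lemma mem_unique_root K (p : {poly subfield_of K}) (x : algC) :
    p != 0 -> root (map_poly val p) x ->
    (forall y, root (map_poly val p) y -> y = x) ->
  x \in K.
Proof.
move=> nz_p px root_eq; set P := map_poly val p in px root_eq.
have nz_P : P != 0 by rewrite map_poly_eq0.
have [rs DP] := closed_field_poly_normal P.
have lead_P : lead_coef P = val (lead_coef p) by rewrite lead_coef_map.
have root_rs z : root P z = (z \in rs).
  by rewrite DP rootZ ?lead_coef_eq0 // root_prod_XsubC.
have rs_x z : z \in rs -> z = x by rewrite -root_rs => /root_eq.
have n_gt0 : (0 < size rs)%N by move: px; rewrite root_rs; case: (rs).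
have sum_roots : \sum_(z <- rs) z = x *+ size rs.
  by rewrite (eq_big_seq _ rs_x) big_const_seq count_predT iter_addr_0.
have coef_P : val (p`_(size rs).-1) = - (val (lead_coef p) * (x *+ size rs)).
  rewrite -[LHS](coef_map val) -/P {1}DP coefZ coefPn_prod_XsubC ?gtn_eqF //.
  by rewrite sum_roots mulrN lead_P.
have Dx : x = - val p`_(size rs).-1 / (val (lead_coef p) *+ size rs).
  rewrite coef_P opprK mulrnAr -mulrnAl mulrC mulKf //.
  by rewrite Num.Theory.mulrn_eq0 negb_or -lt0n n_gt0 fmorph_eq0 lead_coef_eq0.
by rewrite Dx rpred_div ?rpredN ?rpredMn ?(valP (_ : subfield_of K)).
Qed.

Lemma mem_gal_fixed L x : (forall s, fixes L s -> s x = x) -> x \in L.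
Proof.
move=> fix_x; have [p p_min] := subfield_minimal_poly L x.
have [nz_p px _] := p_min; apply: mem_unique_root nz_p px _ => y py.
have [e' [sub_L eq_L] [u Du <-]] :=
  @embedding_extend_root (@Embedding L val) _ _ _ p_min py.
have [s sE] := embedding_extend_fgal e'.
rewrite -sE Du; apply: fix_x => z Lz.
by rewrite -[z]/(val (Subfield (sub_L _ Lz))) sE -(eq_L (Subfield Lz)).
Qed.

Lemma subset_of_fixes K L :
  (forall s, fixes L s -> fixes K s) -> {subset K <= L}.
Proof. by move=> fixLK x Kx; apply: mem_gal_fixed => s /fixLK; apply. Qed.

Lemma sub_adjoin L (T : algC -> Prop) : {subset L <= adjoin L T}.
Proof. by move=> x Lx; apply/asboolP => M LM _; apply: LM. Qed.

Lemma mem_adjoin L (T : algC -> Prop) x : T x -> x \in adjoin L T.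
Proof. by move=> Tx; apply/asboolP => M _; apply. Qed.

Lemma fixes_adjoin L (T : algC -> Prop) s :
  fixes (adjoin L T) s <-> fixes L s /\ fixes_all T s.
Proof.
split=> [fix_s|[fix_L fix_T] x /asboolP/(_ (fixfield (eq s)))].
  split=> [x Lx|z Tz]; apply: fix_s; [exact: sub_adjoin | exact: mem_adjoin].
have fixE z : s z = z -> z \in fixfield (eq s).
  by move=> sz; apply/asboolP => _ <-.
have L_fixed z (Lz : z \in L) := fixE z (fix_L z Lz).
have T_fixed z (Tz : T z) := fixE z (fix_T z Tz).
by move/(_ L_fixed T_fixed)/asboolP; apply.
Qed.

Definition fgal_preim s K : {pred algC} := fun x => s x \in K.

Lemma fgal_preim_divring s K : divring_closed (fgal_preim s K).
Proof.
have preimE x : (x \in fgal_preim s K) = (s x \in K) by [].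
split=> [|x y|x y]; rewrite !preimE ?rmorph1 ?rpred1 // => sx sy.
  by rewrite rmorphB rpredB.
by rewrite fmorph_div rpred_div.
Qed.
HB.instance Definition _ s K :=
  GRing.isDivringClosed.Build algC (fgal_preim s K) (fgal_preim_divring s K).

Lemma adjoin_stable L (T : algC -> Prop) :
  gal_stable T -> stable_over L (adjoin L T).
Proof.
move=> stT s fix_L x /asboolP Mx; apply/asboolP => M LM TM.
apply: (Mx (fgal_preim s M)) => [z Lz|z Tz]; last exact/TM/stT.
by rewrite -[_ \in _]/(s z \in M) fix_L ?LM.
Qed.

Definition common_field L (T U : algC -> Prop) : divringClosed algC :=
  capfield (adjoin L T) (adjoin L U).

Lemma sub_common_field L (T U : algC -> Prop) :
  {subset L <= common_field L T U}.
Proof. by move=> x Lx; apply/andP; split; apply: sub_adjoin. Qed.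

Lemma common_field_stable L (T U : algC -> Prop) :
  gal_stable T -> gal_stable U -> stable_over L (common_field L T U).
Proof.
move=> stT stU s fix_L x /andP[xT xU].
by apply/andP; split; apply: (adjoin_stable _ fix_L).
Qed.

Definition restricts_to K L s (r : relGal K L) :=
  forall u, s (val u) = val (r u).

Lemma restricts_toM K L s s' (r r' : relGal K L) :
  restricts_to s r -> restricts_to s' r' -> restricts_to (s * s')%g (r * r')%g.
Proof. by move=> sr sr' u; rewrite /= sr' sr. Qed.

Lemma restricts_to_eq1 K L s (r : relGal K L) :
  restricts_to s r -> r = 1%g <-> fixes K s.
Proof.
move=> sr; split=> [r1 x Kx|fix_s].
  by rewrite -[x in LHS]/(val (Subfield Kx)) sr r1.
by apply: fgal_eq => u; apply: val_inj; rewrite -sr fix_s //; apply: valP.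
Qed.

Lemma relGal_lift K L (r : relGal K L) : {subset L <= K} ->
  exists2 s, fixes L s & restricts_to s r.
Proof.
move=> LK; have [s sE] := embedding_extend_fgal (@Embedding K (val \o r)).
exists s => // x Lx; rewrite -[x]/(val (Subfield (LK _ Lx))) sE /=.
by rewrite fgal_fix.
Qed.

Lemma relGal_restrict K L s : stable_over L K -> fixes L s ->
  exists r : relGal K L, restricts_to s r.
Proof.
move=> stK fix_s; have sK := stK _ fix_s; have sVK := stK _ (fixesV fix_s).
pose f t (tK : {homo t : x / x \in K}) (u : subfield_of K) : subfield_of K :=
  Subfield (tK _ (valP u)).
have gal_f : is_fgal [pred x : subfield_of K | val x \in L] (f _ sK).
  split=> [u v||| u Lu].
  - by apply: val_inj; rewrite /= rmorphB.
  - by split=> [|u v]; apply: val_inj; rewrite /= ?rmorph1 ?rmorphM.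
  - by exists (f _ sVK) => u; apply: val_inj; rewrite /= ?fgal_invK ?fgal_invKV.
  - by apply: val_inj; rewrite /= fix_s.
by exists (MkFgal gal_f).
Qed.

End FixedFields.

Section GroupIso.
Implicit Types G H K : groupType.

Lemma group_iso_sym G H : group_iso G H -> group_iso H G.
Proof.
case=> f fM [g fK gK]; exists g; last by exists f.
by move=> x y; apply: (can_inj fK); rewrite fM !gK.
Qed.

Lemma group_iso_trans H G K : group_iso G H -> group_iso H K -> group_iso G K.
Proof.
move=> [f fM f_bij] [g gM g_bij]; exists (g \o f); last exact: bij_comp.
by move=> x y /=; rewrite fM gM.
Qed.

Lemma correspondence_functional G H (R : G -> H -> Prop) x y y' :
    (forall x x' y y', R x y -> R x' y' -> R (x * x')%g (y * y')%g) ->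
    (forall x, exists y, R x y) -> (forall y, R 1%g y -> y = 1%g) ->
  R x y -> R x y' -> y = y'.
Proof.
move=> RM R_total R1 Rxy Rxy'; have [z Rz] := R_total (x^-1)%g.
have inverse_z w : R x w -> (w * z)%g = 1%g.
  by move=> Rxw; apply: R1; rewrite -(mulgV x); apply: RM.
by apply: (mulIg z); rewrite !inverse_z.
Qed.

Lemma group_iso_correspondence G H (R : G -> H -> Prop) :
    (forall x x' y y', R x y -> R x' y' -> R (x * x')%g (y * y')%g) ->
    (forall x, exists y, R x y) -> (forall y, exists x, R x y) ->
    (forall x y, R x y -> x = 1%g <-> y = 1%g) ->
  group_iso G H.
Proof.
move=> RM R_total R_onto R1.
have R_functional x y y' : R x y -> R x y' -> y = y'.
  by apply: correspondence_functional => // y1 /R1[+ _]; apply.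
have R_injective x x' y : R x y -> R x' y -> x = x'.
  apply: (@correspondence_functional _ _ (fun y x => R x y)) => //.
    by move=> y1 y2 x1 x2; apply: RM.
  by move=> x1 /R1[_]; apply.
have [[f Rf] [g Rg]] := (choice R_total, choice R_onto).
exists f; first by move=> x x'; apply: R_functional (Rf _) (RM _ _ _ _ _ _).
exists g => [x|y]; first exact: R_injective (Rg _) (Rf _).
exact: R_functional (Rf _) (Rg _).
Qed.

End GroupIso.

Lemma isog_group_iso (gT rT : finGroupType) (G : {group gT}) (H : {group rT}) :
  G \isog H -> group_iso (subg_of G) (subg_of H).
Proof.
case/isogP=> h /injmP h_inj hG.
have Hh (u : subg_of G) : h (sgval u) \in H by rewrite -hG mem_morphim ?subgP.
have sgval_h (u : subg_of G) : sgval (subg H (h (sgval u))) = h (sgval u).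
  by rewrite subgK.
exists (fun u => subg H (h (sgval u))) => [u v|].
  by rewrite /= morphM ?subgP // subgM.
apply: inj_card_bij => [u v /(congr1 sgval)|].
  by rewrite !sgval_h => /h_inj-/(_ (subgP u) (subgP v))/val_inj.
by rewrite -!cardsT -!(card_isog (isog_subg _)) -hG card_injm //; apply/injmP.
Qed.

Section GaloisImage.
Variables (gT : finGroupType) (phi : UMagmaMorphism.type (fgal Crat) gT).
Implicit Types (K L : divringClosed algC) (s t : fgal Crat) (S : {pred algC}).

Definition gal_image S : {set gT} :=
  [set g | `[< exists2 s, fixes S s & phi s = g >]].

Lemma gal_imageP S g :
  reflect (exists2 s, fixes S s & phi s = g) (g \in gal_image S).
Proof. by rewrite inE; apply: asboolP. Qed.

Lemma gal_image_group_set S : group_set (gal_image S).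
Proof.
apply/group_setP; split=> [|_ y /gal_imageP[s fix_s <-]].
  by apply/gal_imageP; exists 1%g; rewrite ?gmulf1.
case/gal_imageP=> t fix_t <-.
by apply/gal_imageP; exists (s * t)%g; rewrite ?gmulfM //; apply: fixesM.
Qed.
Canonical gal_image_group S := Group (gal_image_group_set S).

Lemma gal_image_normal K L :
  {subset L <= K} -> stable_over L K -> (gal_image K <| gal_image L)%g.
Proof.
move=> LK stK; apply/andP; split; apply/subsetP => _ /gal_imageP[s fix_s <-].
  by apply/gal_imageP; exists s => // x /LK/fix_s.
rewrite inE; apply/subsetP => _ /imsetP[_ /gal_imageP[t fix_t <-] ->].
apply/gal_imageP; exists (t ^ s)%g; last by rewrite gmulfJ.
by move=> x Kx; rewrite /conjg /= fix_t ?fgal_invK //; apply: (stK s).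
Qed.

Lemma relGal_quotient K L :
    {subset L <= K} -> stable_over L K ->
    (forall s, fixes L s -> phi s = 1%g -> fixes K s) ->
  group_iso (relGal K L) (subg_of (gal_image_group L / gal_image_group K)%G).
Proof.
move=> LK stK ker_phi; have nKL := gal_image_normal LK stK.
have normK s : fixes L s -> phi s \in 'N(gal_image K)%g.
  by move=> fix_s; apply/(subsetP (normal_norm nKL))/gal_imageP; exists s.
pose Q := (gal_image_group L / gal_image_group K)%G.
pose R (r : relGal K L) (y : subg_of Q) := exists s,
  [/\ fixes L s, restricts_to s r & coset (gal_image K) (phi s) = val y].
apply: (@group_iso_correspondence _ _ R) => [r r' y y'|r|y|r y].
- move=> [s [fix_s sr sy]] [s' [fix_s' sr' sy']]; exists (s * s')%g; split.
  + exact: fixesM.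
  + exact: restricts_toM.
  + by rewrite gmulfM morphM ?normK //= sy sy'.
- have [s fix_s sr] := relGal_lift r LK.
  have Qs : coset (gal_image K) (phi s) \in Q.
    by apply: mem_quotient; apply/gal_imageP; exists s.
  by exists (subg _ (coset _ (phi s))); exists s; rewrite subgK.
- have /morphimP[_ _ /gal_imageP[s fix_s <-] Dy] := subgP y.
  by have [r sr] := relGal_restrict stK fix_s; exists r, s.
- move=> [s [fix_s sr sy]]; rewrite (restricts_to_eq1 sr).
  have -> : y = 1%g <-> coset (gal_image K) (phi s) = 1%g.
    by rewrite sy; split=> [->|y1] //; apply: val_inj.
  split=> [fix_K|/(coset_idr (normK s fix_s))/gal_imageP[t fix_t ts]].
    by apply: coset_id; apply/gal_imageP; exists s.
  rewrite -[s](mulKVg t); apply: fixesM => //; apply: ker_phi.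
    by apply: fixesM => //; apply: fixesV => x /LK/fix_t.
  by rewrite gmulfM gmulfV ts mulVg.
Qed.

End GaloisImage.

Section FixedFieldOfPreimage.
Variables (gT : finGroupType) (phi : UMagmaMorphism.type (fgal Crat) gT).
Implicit Types s t u : fgal Crat.

Definition cuts_out (T : algC -> Prop) :=
  forall s, phi s = 1%g <-> fixes_all T s.

Lemma cuts_out_eq (T : algC -> Prop) s t :
  cuts_out T -> phi s = phi t <-> (forall z, T z -> s z = t z).
Proof.
move=> cutT; have -> : phi s = phi t <-> phi (t^-1 * s)%g = 1%g.
  rewrite gmulfM gmulfV; split=> [->|/eqP]; first exact: mulVg.
  by rewrite -eq_mulVg1 => /eqP.
rewrite cutT; split=> st z Tz; last by rewrite /= st ?fgal_invK.
by apply: (can_inj (fgalK t^-1%g)); rewrite fgalK -[RHS](st z Tz).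
Qed.

Definition gal_repr (g : gT) : fgal Crat :=
  if pselect (exists s, phi s = g) is left ex_s then sval (cid ex_s) else 1%g.

Lemma gal_reprK s : phi (gal_repr (phi s)) = phi s.
Proof.
by rewrite /gal_repr; case: pselect => [ex_s|[]]; [case: cid | exists s].
Qed.

Section OrbitPolynomial.
Variables (J : {group gT}) (f : {poly algC}).
Hypothesis phi_f : forall s t, phi s = phi t -> map_poly s f = map_poly t f.

Definition conjugate g := map_poly (gal_repr g) f.

Definition orbit_poly : {poly {poly algC}} :=
  \prod_(g in J :&: gal_image phi Crat) ('X - (conjugate g)%:P).

Lemma conjugateE s : conjugate (phi s) = map_poly s f.
Proof. exact/phi_f/gal_reprK. Qed.

Lemma map_conjugate s t :
  map_poly s (conjugate (phi t)) = conjugate (phi s * phi t)%g.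
Proof. by rewrite -gmulfM !conjugateE -map_poly_comp. Qed.

Lemma map_orbit_poly s : map_poly (map_poly s) orbit_poly
  = \prod_(g in J :&: gal_image phi Crat) ('X - (conjugate (phi s * g)%g)%:P).
Proof.
rewrite rmorph_prod; apply: eq_bigr => _ /setIP[_ /gal_imageP[t _ <-]].
by rewrite rmorphB /= map_polyX map_polyC /= map_conjugate.
Qed.

Lemma map_orbit_poly_id s :
  phi s \in J -> map_poly (map_poly s) orbit_poly = orbit_poly.
Proof.
move=> Js; rewrite map_orbit_poly [RHS](reindex_inj (mulgI (phi s))).
pose J' := (J :&: gal_image_group phi Crat)%G.
apply: eq_bigl => g; apply: esym; apply: (groupMl (G := J')).
by rewrite inE Js; apply/gal_imageP; exists s; first exact: fixes_Crat.
Qed.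

(* [s] fixes the coefficients of the orbit polynomial of [f], hence permutes
   its roots. *)
Lemma fixfield_conjugate s :
    fixes (fixfield (fun t => phi t \in J)) s ->
  exists2 t, phi t \in J & map_poly s f = map_poly t f.
Proof.
move=> fix_s.
have orbit_s : map_poly (map_poly s) orbit_poly = orbit_poly.
  apply/polyP => i; rewrite coef_map; apply/polyP => j; rewrite coef_map /=.
  apply: fix_s; apply/asboolP => t /map_orbit_poly_id {2}<-.
  by rewrite !coef_map.
have: root orbit_poly (map_poly s f).
  rewrite -orbit_s map_orbit_poly (bigD1 1%g) /=.
    by rewrite rootM root_XsubC mulg1 conjugateE eqxx.
  exact: (group1 (J :&: gal_image_group phi Crat)%G).
rewrite /root horner_prod prodf_seq_eq0 => /hasP[g _ /andP[]].
move=> /setIP[Jg /gal_imageP[t _ Dg]]; rewrite -Dg in Jg *.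
by rewrite hornerXsubC subr_eq0 conjugateE => /eqP; exists t.
Qed.

End OrbitPolynomial.

(* If [phi s] were not in [J], then for every [g] in [J] some [z] in [T] would
   separate [s] from [g]; the polynomial with these [z] as coefficients would
   have a conjugate under [s] outside its orbit. *)
Lemma fixfield_preim_closed (T : algC -> Prop) (J : {group gT}) s :
  cuts_out T -> fixes (fixfield (fun t => phi t \in J)) s -> phi s \in J.
Proof.
move=> cutT fix_s.
have separate g : exists z, (forall t u, phi t = phi u -> t z = u z) /\
    (s z = gal_repr g z -> phi s = phi (gal_repr g)).
  have [eq_s|/existsNP[z /not_implyP[Tz neq_z]]] :=
    pselect (forall z, T z -> s z = gal_repr g z).
    exists 0; split=> [t u _|_]; first by rewrite !rmorph0.
    exact/(cuts_out_eq _ _ cutT).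
  by exists z; split=> // t u /(cuts_out_eq _ _ cutT)->.
have [z zP] := choice separate.
pose f := \poly_(i < #|gT|) z (nth 1%g (enum gT) i).
have coef_f g : f`_(index g (enum gT)) = z g.
  by rewrite coef_poly cardE index_mem mem_enum nth_index ?mem_enum.
have phi_f t u : phi t = phi u -> map_poly t f = map_poly u f.
  move=> tu; apply/polyP => i; rewrite !coef_map coef_poly; case: ifP => _.
    exact: (zP _).1.
  by rewrite /= !rmorph0.
have [t Jt /(congr1 (fun h : {poly algC} => h`_(index (phi t) (enum gT))))] :=
  fixfield_conjugate phi_f fix_s.
rewrite !coef_map coef_f /= => st; rewrite ((zP (phi t)).2 _) ?gal_reprK // st.
by apply: (zP _).1; rewrite gal_reprK.
Qed.

End FixedFieldOfPreimage.

Section DisjointFields.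
Variables (gT rT : finGroupType).
Variable f : UMagmaMorphism.type (fgal Crat) gT.
Variable g : UMagmaMorphism.type (fgal Crat) rT.
Variables S T : algC -> Prop.
Hypotheses (S_stable : gal_stable S) (T_stable : gal_stable T).
Hypotheses (f_cuts : cuts_out f S) (g_cuts : cuts_out g T).
Implicit Types s t u : fgal Crat.

Hypothesis disjoint_fields :
  forall r : relGal (common_field Crat S T) Crat, r = 1%g.

(* An element of Q(S) fixed by the preimage of [f (ker g)] lies in
   Q(S) cap Q(T) = Q. *)
Lemma disjoint_fields_lift s : exists2 t, g t = 1%g & f t = f s.
Proof.
have gal_adjoin_T t : fixes (adjoin Crat T) t <-> g t = 1%g.
  rewrite fixes_adjoin g_cuts; split=> [[_] //|fix_T].
  by split=> //; apply: fixes_Crat.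
suff: f s \in gal_image_group f (adjoin Crat T).
  by case/gal_imageP=> t /gal_adjoin_T gt ts; exists t.
apply: (fixfield_preim_closed f_cuts) => x /asboolP fix_x.
have xS : x \in adjoin Crat S.
  apply: mem_gal_fixed => t /fixes_adjoin[_ /f_cuts t1].
  by apply: fix_x; rewrite t1 group1.
have xT : x \in adjoin Crat T.
  by apply: mem_gal_fixed => t fix_t; apply: fix_x; apply/gal_imageP; exists t.
have x_common : x \in common_field Crat S T by apply/andP.
have stable_common := common_field_stable (L := Crat) S_stable T_stable.
have [r sr] := relGal_restrict stable_common (fixes_Crat s).
by rewrite -[LHS]/(s (val (Subfield x_common))) sr (disjoint_fields r).
Qed.

Lemma disjoint_fields_joint s u : exists2 t, f t = f s & g t = g u.
Proof.
have [t gt ft] := disjoint_fields_lift (s * u^-1)%g.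
exists (t * u)%g; last by rewrite gmulfM gt mul1g.
by rewrite gmulfM ft -gmulfM mulgKV.
Qed.

Section Graph.
Variables (A : {group gT}) (tau : UMagmaMorphism.type gT rT).
Hypothesis tau_inj : injective tau.

Definition graph_of : {set gT * rT} :=
  [set x | (x.1 \in A) && (x.2 == tau x.1)].

Lemma graph_of_group_set : group_set graph_of.
Proof.
apply/group_setP; split=> [|[x1 y1] [x2 y2]]; rewrite !inE /=.
  by rewrite group1 gmulf1 /=.
by case/andP=> Ax1 /eqP-> /andP[Ax2 /eqP->]; rewrite groupM // gmulfM /=.
Qed.
Canonical graph_of_group := Group graph_of_group_set.

Definition joint s := (f s, g s).

Lemma joint1 : joint 1%g = 1%g.
Proof. by rewrite /joint !gmulf1. Qed.

Lemma jointM : {morph joint : s t / (s * t)%g}.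
Proof. by move=> s t; rewrite /joint !gmulfM. Qed.

HB.instance Definition _ := isUMagmaMorphism.Build _ _ joint (joint1, jointM).

Lemma joint_cuts : cuts_out joint (fun z => S z \/ T z).
Proof.
move=> s; split=> [[/f_cuts fix_S /g_cuts fix_T] z [/fix_S|/fix_T] //|fix_s].
by congr (_, _); [apply/f_cuts | apply/g_cuts] => z z_in; apply: fix_s;
  [left | right].
Qed.

Definition graph_field : divringClosed algC :=
  fixfield (fun s => joint s \in graph_of).

Lemma fixes_graph_field s :
  fixes graph_field s <-> f s \in A /\ g s = tau (f s).
Proof.
have -> : f s \in A /\ g s = tau (f s) <-> joint s \in graph_of.
  by rewrite inE /=; split=> [[-> ->]|/andP[? /eqP]]; rewrite ?eqxx.
split=> [|graph_s x /asboolP]; last exact.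
exact: (fixfield_preim_closed (J := graph_of_group) joint_cuts).
Qed.

Lemma fixes_graph_field_ker s : fixes graph_field s -> f s = 1%g <-> g s = 1%g.
Proof.
case/fixes_graph_field=> _ ->; split=> [->|]; first exact: gmulf1.
by move=> tau_fs; apply: tau_inj; rewrite tau_fs gmulf1.
Qed.

Lemma gal_image_graph_field :
  (forall x, x \in A -> exists s, f s = x) ->
  (forall x, x \in A -> exists s, g s = tau x) ->
  gal_image f graph_field = A.
Proof.
move=> f_onto g_onto; apply/setP => x; apply/gal_imageP/idP.
  by case=> s /fixes_graph_field[As _] <-.
move=> Ax; have [[s fs] [u gu]] := (f_onto x Ax, g_onto x Ax).
have [t ft gt] := disjoint_fields_joint s u.
by exists t; rewrite ?ft //; apply/fixes_graph_field; rewrite ft fs gt gu.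
Qed.

(* Over the graph field the kernels of [f] and [g] coincide, hence so do the
   fields that they cut out. *)
Lemma gal_image_common_graph_field :
  gal_image f (common_field graph_field S T) = 1%g.
Proof.
apply/trivgP/subsetP => _ /gal_imageP[s fix_s <-]; apply/set1P/f_cuts => z Sz.
apply: fix_s; apply/andP; split; first exact: mem_adjoin.
move: (mem_adjoin graph_field Sz); apply: subset_of_fixes => t /fixes_adjoin.
case=> fix_t /g_cuts/(fixes_graph_field_ker fix_t)/f_cuts tS.
exact/fixes_adjoin.
Qed.

Lemma relGal_graph_field :
    (forall x, x \in A -> exists s, f s = x) ->
    (forall x, x \in A -> exists s, g s = tau x) ->
  group_iso (relGal (common_field graph_field S T) graph_field) (subg_of A).
Proof.
move=> f_onto g_onto.
have fix_common s : fixes graph_field s -> f s = 1%g ->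
    fixes (common_field graph_field S T) s.
  move=> fix_s /f_cuts sS x /andP[xS _]; move: x xS; exact/fixes_adjoin.
have stable_common := common_field_stable (L := graph_field) S_stable T_stable.
have := relGal_quotient (@sub_common_field _ _ _) stable_common fix_common.
move/group_iso_trans; apply.
apply: isog_group_iso => /=.
rewrite gal_image_graph_field // gal_image_common_graph_field.
by rewrite isog_sym; apply: quotient1_isog.
Qed.

End Graph.
End DisjointFields.

(** * Subgroups of the symmetric group on three letters *)

Lemma subg_setT_group_iso (gT : finGroupType) :
  group_iso (subg_of [set: gT]%G) gT.
Proof.
exists sgval => [u v|]; first by [].
exists (subg [set: gT]) => [u|x]; first exact: sgvalK.
by apply: subgK; rewrite inE.
Qed.

Lemma isog_setT_group_iso (gT rT : finGroupType) (G : {group gT}) :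
  G \isog [set: rT] -> group_iso (subg_of G) rT.
Proof.
move=> isoG; apply: group_iso_trans (subg_setT_group_iso rT).
exact: (isog_group_iso (H := [set: rT]%G)).
Qed.

Lemma cyclic_group_iso (gT : finGroupType) (G : {group gT}) n :
  cyclic G -> #|G| = n.+1 -> group_iso (subg_of G) 'I_n.+1.
Proof.
move=> cycG cardG; apply: isog_setT_group_iso.
rewrite isog_cyclic_card //= Zp_cycle cycle_cyclic -Zp_cycle.
by rewrite cardsT card_ord cardG eqxx.
Qed.

Lemma trivial_group_iso (gT : finGroupType) (G : {group gT}) :
  #|G| = 1%N -> group_iso (subg_of G) 'I_1.
Proof.
move=> cardG; have cycG : cyclic G by rewrite (card1_trivg cardG) cyclic1.
exact: cyclic_group_iso cycG cardG.
Qed.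

Lemma prime_group_iso (gT : finGroupType) (G : {group gT}) p :
  prime p -> #|G| = p -> group_iso (subg_of G) 'Z_p.
Proof.
move=> pr_p cardG; apply: cyclic_group_iso.
  by rewrite prime_cyclic ?cardG.
by rewrite cardG Zp_cast ?prime_gt1.
Qed.

Lemma quotient_isog_setT (gT : finGroupType) (G N : {group gT}) :
  (N <| G)%g -> #|(G / N)%g| = #|gT| -> (G / N \isog [set: gT])%g.
Proof.
move=> nNG cardGN.
have cardG : #|G| = (#|gT| * #|N|)%N.
  by rewrite -cardGN card_quotient ?normal_norm // mulnC Lagrange ?normal_sub.
have gT_gt0 : (0 < #|gT|)%N by rewrite -cardGN cardG_gt0.
have N1 : N :=: 1%g.
  apply: card1_trivg; apply/eqP; rewrite eqn_leq cardG_gt0 andbT.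
  by rewrite -(leq_pmul2l gT_gt0) muln1 -cardG max_card.
have -> : [set: gT] = G.
  by apply/esym/eqP; rewrite eqEcard subsetT cardsT cardG leq_pmulr ?cardG_gt0.
by rewrite N1 isog_sym; apply: quotient1_isog.
Qed.

Definition S3_subgroup_type (G : groupType) :=
  [\/ group_iso G 'I_1, group_iso G 'Z_2, group_iso G 'Z_3 | group_iso G 'S_3].

Lemma S3_subgroup_type_iso (G H : groupType) :
  group_iso G H -> S3_subgroup_type H -> S3_subgroup_type G.
Proof.
move=> GH [] H_iso; [apply: Or41 | apply: Or42 | apply: Or43 | apply: Or44];
  exact: group_iso_trans GH H_iso.
Qed.

Lemma Sn_subquotient_type n (I N : {group 'S_n}) :
  (n <= 3)%N -> (N <| I)%g -> S3_subgroup_type (subg_of (I / N)%G).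
Proof.
move=> n_le3 nNI; have dvdIN : (#|(I / N)%g| %| n`!)%N.
  rewrite card_quotient ?normal_norm // -card_Sn -cardsT.
  by apply: dvdn_trans (dvdn_indexg _ _) (cardSg (subsetT _)).
have n_dvd6 : (n`! %| 6)%N by case: n n_le3 {I N nNI dvdIN} => [|[|[|[]]]].
have: #|(I / N)%g| \in divisors 6.
  by rewrite -dvdn_divisors // (dvdn_trans dvdIN).
rewrite (_ : divisors 6 = [:: 1; 2; 3; 6]%N) // !inE => /or4P[]/eqP cardIN.
- exact/Or41/trivial_group_iso.
- exact/Or42/(@prime_group_iso _ _ 2).
- exact/Or43/(@prime_group_iso _ _ 3).
have n3 : n = 3%N.
  move: dvdIN; rewrite cardIN.
  by case: n n_le3 {I N nNI n_dvd6 cardIN} => [|[|[|[]]]].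
subst n; apply/Or44/isog_setT_group_iso/quotient_isog_setT => //.
by rewrite [LHS]cardIN card_Sn.
Qed.

Lemma S3_subgroup_type_card6 (gT : finGroupType) (G : {group gT}) :
  #|G| = 6%N -> S3_subgroup_type (subg_of G) -> group_iso (subg_of G) 'S_3.
Proof.
rewrite (card_isog (isog_subg G)) cardsT => cardG.
by case=> // -[f _ /bij_eq_card]; rewrite cardG card_ord.
Qed.

(** * Torsion fields and entanglement *)

Lemma rat_poly_roots (p : {poly rat}) : p != 0 ->
  exists rs : seq algC, [/\ uniq rs, (size rs < size p)%N
    & forall z, (z \in rs) = root (map_poly ratr p) z].
Proof.
rewrite -(map_poly_eq0 (ratr : rat -> algC)) => nz_p.
have [rs Dp] := closed_field_poly_normal (map_poly ratr p : {poly algC}).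
have nz_lead := lead_coef_eq0 (map_poly ratr p : {poly algC}).
exists (undup rs); split=> [||z]; first exact: undup_uniq.
  apply: leq_ltn_trans (size_undup rs) _.
  rewrite -(size_map_poly (ratr : rat -> algC)).
  by rewrite Dp size_scale ?nz_lead // size_prod_XsubC.
by rewrite mem_undup Dp rootZ ?nz_lead // root_prod_XsubC.
Qed.

Section PermutationOfRoots.
Variable rs : seq algC.
Hypotheses (uniq_rs : uniq rs) (rs_stable : gal_stable (fun z => z \in rs)).
Implicit Types (s t : fgal Crat) (i : 'I_(size rs)).

Lemma perm_roots_subproof s i : (index (s rs`_i)%R rs < size rs)%N.
Proof. by rewrite index_mem rs_stable ?mem_nth. Qed.

Definition perm_roots_fun s i := Ordinal (perm_roots_subproof s i).

Lemma perm_roots_funE s i : rs`_(perm_roots_fun s i) = s rs`_i.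
Proof. by rewrite nth_index ?rs_stable ?mem_nth. Qed.

Lemma nth_roots_inj : injective (fun i => rs`_i).
Proof. by move=> i j /eqP; rewrite nth_uniq // => /eqP/val_inj. Qed.

Lemma perm_roots_fun_inj s : injective (perm_roots_fun s).
Proof.
move=> i j eq_ij; apply/nth_roots_inj/(bij_inj (fgal_bij s)).
by rewrite -!perm_roots_funE eq_ij.
Qed.

(* Permutations act on the right, automorphisms on the left. *)
Definition perm_roots s : 'S_(size rs) := perm (@perm_roots_fun_inj s^-1%g).

Lemma perm_rootsE s i : rs`_(perm_roots s i) = (s^-1)%g rs`_i.
Proof. by rewrite permE perm_roots_funE. Qed.

Lemma perm_roots1 : perm_roots 1%g = 1%g.
Proof.
by apply/permP => i; apply: nth_roots_inj; rewrite perm_rootsE invg1 perm1.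
Qed.

Lemma perm_rootsM : {morph perm_roots : s t / (s * t)%g}.
Proof.
move=> s t; apply/permP => i; apply: nth_roots_inj.
by rewrite permM !perm_rootsE invMg.
Qed.

HB.instance Definition _ :=
  isUMagmaMorphism.Build _ _ perm_roots (perm_roots1, perm_rootsM).

Lemma perm_roots_ker s : perm_roots s = 1%g -> fixes (mem rs) s.
Proof.
move=> s1 z /(nthP 0)[i ltis <-]; rewrite -[i]/(val (Ordinal ltis)).
by rewrite -{1}[Ordinal _](perm1) -s1 perm_rootsE (fgalVK s).
Qed.

End PermutationOfRoots.

Section Torsion.
Variable E : elliptic_curve.
Implicit Types (L : divringClosed algC) (s : fgal Crat).

Lemma torsion_coord_stable n : gal_stable (torsion_coord E n).
Proof.
move=> s z [x [y [Txy Dz]]]; exists (s x), (s y); split.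
  exact: (ec_act_torsion s Txy).
by case: Dz => ->; [left | right].
Qed.

Definition two_division_poly : {poly rat} :=
  Poly [:: 4 * ec_a6 E + ec_a3 E ^+ 2; 4 * ec_a4 E + 2 * ec_a1 E * ec_a3 E;
           4 * ec_a2 E + ec_a1 E ^+ 2; 4].

Lemma size_two_division_poly : size two_division_poly = 4%N.
Proof. by rewrite (@PolyK _ 0). Qed.

Lemma two_torsion_neg x y : ec_torsion E 2 (Aff x y) ->
  y + y + ratr (ec_a1 E) * x + ratr (ec_a3 E) = 0.
Proof. by case/andP=> _ /=; rewrite eqxx /=; case: ifP => // /eqP. Qed.

(* (2y + a1 x + a3)^2 is the 2-division polynomial modulo the equation of the
   curve. *)
Lemma two_torsion_root x y :
  ec_torsion E 2 (Aff x y) -> root (map_poly ratr two_division_poly) x.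
Proof.
move=> Txy; have y2 := two_torsion_neg Txy.
have /andP[/= /eqP xy_curve _] := Txy.
rewrite /root horner_coef size_map_poly size_two_division_poly.
rewrite !big_ord_recr big_ord0 /= !coef_map !coef_Poly /=.
rewrite !(rmorphD, rmorphM, rmorphXn, rmorph_nat) /= expr0 expr1 mulr1 add0r.
move: xy_curve y2; set a1 := ratr _; set a3 := ratr _; set a2 := ratr _.
set a4 := ratr _; set a6 := ratr _ => xy_curve y2; apply/eqP.
rewrite [LHS](_ : _ = (y + y + a1 * x + a3) ^+ 2
  - 4 * ((y ^+ 2 + a1 * x * y + a3 * y)
         - (x ^+ 3 + a2 * x ^+ 2 + a4 * x + a6))); last by ring.
by rewrite y2 xy_curve subrr mulr0 subr0 expr2 mulr0.
Qed.

Lemma two_torsion_fixed s x y : ec_torsion E 2 (Aff x y) -> s x = x -> s y = y.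
Proof.
move/two_torsion_neg=> y2 sx.
have -> : y = - (ratr (ec_a1 E) * x + ratr (ec_a3 E)) / 2.
  apply: (canRL (mulfK _)); first by rewrite Num.Theory.pnatr_eq0.
  apply: (addIr (ratr (ec_a1 E) * x + ratr (ec_a3 E))).
  by rewrite addNr -y2; ring.
by rewrite fmorph_div rmorphN rmorphD rmorphM !fmorph_rat rmorph_nat /= sx.
Qed.

Lemma two_torsion_roots : exists rs : seq algC,
  [/\ uniq rs, (size rs <= 3)%N, gal_stable (fun z => z \in rs)
    & forall s, fixes (mem rs) s -> fixes_all (torsion_coord E 2) s].
Proof.
have [|rs [uniq_rs size_rs rsE]] := @rat_poly_roots two_division_poly.
  by rewrite -size_poly_eq0 size_two_division_poly.
exists rs; split=> // [|s z|s fix_s z [x [y [Txy Dz]]]].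
- by rewrite size_two_division_poly in size_rs.
- rewrite !rsE -(fmorph_root s) -map_poly_comp /=.
  by rewrite (eq_map_poly (fmorph_rat s)).
- have sx : s x = x by apply: fix_s; rewrite rsE (two_torsion_root Txy).
  by case: Dz => -> //; apply: two_torsion_fixed Txy sx.
Qed.

Lemma entanglement_quotient L m n (gT : finGroupType)
    (phi : UMagmaMorphism.type (fgal Crat) gT) :
    (forall s, phi s = 1%g -> fixes_all (torsion_coord E m) s) ->
  exists I N : {group gT},
  [/\ (N <| I)%g, (#|(I / N)%g| %| #|gal_image phi Crat|)%N
    & group_iso (entanglement E m n L) (subg_of (I / N)%G)].
Proof.
move=> phi_ker.
pose K := common_field L (torsion_coord E m) (torsion_coord E n).
have sub_LK : {subset L <= K} := @sub_common_field _ _ _.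
have stable_K : stable_over L K.
  by apply: common_field_stable; apply: torsion_coord_stable.
have nKL := gal_image_normal phi sub_LK stable_K.
exists (gal_image_group phi L), (gal_image_group phi K); split=> //.
- rewrite card_quotient ?normal_norm //; apply: dvdn_trans (dvdn_indexg _ _) _.
  apply: (@cardSg _ (gal_image_group phi Crat)).
  apply/subsetP => _ /gal_imageP[s _ <-]; apply/gal_imageP; exists s => //.
  exact: fixes_Crat.
- apply: relGal_quotient => // s fix_L /phi_ker fix_m x /andP[x_m _].
  by move: x x_m; apply/fixes_adjoin.
Qed.

Lemma Ent_iso m n (G H : groupType) :
  group_iso G H -> Ent E m n H -> Ent E m n G.
Proof. by move=> GH [L HL]; exists L; apply: group_iso_trans HL. Qed.

Lemma Ent_two_S3_subgroup_type n (G : groupType) :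
  Ent E 2 n G -> S3_subgroup_type G.
Proof.
case=> L GL; apply: S3_subgroup_type_iso GL _.
have [rs [uniq_rs size_rs rs_stable rs_fixed]] := two_torsion_roots.
have [|I [N [nNI _ isoIN]]] :=
  @entanglement_quotient L 2 n _ (perm_roots uniq_rs rs_stable) _.
  by move=> s /perm_roots_ker/rs_fixed.
exact/(S3_subgroup_type_iso isoIN)/Sn_subquotient_type.
Qed.

Section Rho.
Variables (n : nat) (B : torsion_basis E n).

Lemma rho1 : rho B 1%g = 1%g.
Proof. by apply: val_inj; apply: rho_mx1. Qed.

HB.instance Definition _ := isUMagmaMorphism.Build _ _ (rho B) (rho1, rhoM B).

Definition rho_morphism : UMagmaMorphism.type (fgal Crat) {'GL_2['Z_n]} :=
  rho B.

Lemma gal_image_rho : gal_image rho_morphism Crat = rho_img B.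
Proof.
apply/setP => g; rewrite [RHS]inE.
apply/gal_imageP/asboolP => [[s _ sg]|[s sg]]; exists s => //.
exact: fixes_Crat.
Qed.

Lemma rho_cuts_out : cuts_out rho_morphism (torsion_coord E n).
Proof.
move=> s; have -> : rho_morphism s = 1%g <-> forall v, ec_act s (B v) = B v.
  split=> [/(congr1 val)/= rs v|sB]; first by rewrite -rho_mxP rs mul1mx.
  apply: val_inj => /=; apply: mulcV_inj => v; apply: (@tb_inj _ _ B).
  by rewrite rho_mxP sB mul1mx.
split=> [sB z [x [y [/(tb_img B)[v Bv] Dz]]]|tor_s v].
  by have := sB v; rewrite Bv /= => -[sx sy]; case: Dz => ->.
case Bv: (B v) => [|x y] //=.
have Txy : ec_torsion E n (Aff x y) by apply/(tb_img B); exists v.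
by rewrite !tor_s //; exists x, y; split=> //; [right | left].
Qed.

End Rho.

Lemma Ent_card_dvd m n (B : torsion_basis E m) (G : groupType) : Ent E m n G ->
  exists (gT : finGroupType) (H : {group gT}),
    group_iso G (subg_of H) /\ (#|H| %| #|rho_img B|)%N.
Proof.
case=> L GL; have [|I [N [_ cardIN isoIN]]] :=
  @entanglement_quotient L m n _ (rho_morphism B) _.
  by move=> s /rho_cuts_out.
exists _, (I / N)%G; split; first exact: group_iso_trans GL isoIN.
by rewrite -gal_image_rho.
Qed.

Definition realises_subgroups m n (B : torsion_basis E m) :=
  forall A : {group {'GL_2['Z_m]}},
    A \subset rho_img B -> Ent E m n (subg_of A).

Lemma realises_subgroups_of_disjoint m n
    (Bm : torsion_basis E m) (Bn : torsion_basis E n)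
    (tau : UMagmaMorphism.type {'GL_2['Z_m]} {'GL_2['Z_n]}) :
    injective tau -> (forall s : entanglement E m n Crat, s = 1%g) ->
    (forall g, exists s, rho Bn s = g) ->
  realises_subgroups n Bm.
Proof.
move=> tau_inj triv_ent rhon_onto A /subsetP A_im.
exists (graph_field (rho_morphism Bm) (rho_morphism Bn) A tau).
have stable k := torsion_coord_stable k; have cuts k := @rho_cuts_out k.
apply/group_iso_sym/(relGal_graph_field (stable m) (stable n)) => //.
by move=> x /A_im; rewrite inE => /asboolP.
Qed.

End Torsion.

(** * The embedding of GL_2(Z/2) into GL_2(R) *)

Lemma ord2_ind (P : 'I_2 -> Prop) : P 0 -> P 1 -> forall i, P i.
Proof.
by move=> P0 P1 [[|[|//]] lt_i2];
  [have -> : Ordinal lt_i2 = 0 by apply: val_inj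
  |have -> : Ordinal lt_i2 = 1 by apply: val_inj].
Qed.

Lemma sum_ord2 (V : nmodType) (F : 'I_2 -> V) : \sum_i F i = F 0 + F 1.
Proof.
by rewrite !big_ord_recr big_ord0 /= add0r; congr (F _ + F _); apply: val_inj.
Qed.

Lemma det_mx22 (R : comNzRingType) (A : 'M[R]_2) :
  \det A = A 0 0 * A 1 1 - A 0 1 * A 1 0.
Proof.
have lift0 : lift 0 0 = 1 :> 'I_2 by apply: val_inj.
have lift1 : lift 1 0 = 0 :> 'I_2 by apply: val_inj.
rewrite (expand_det_row _ 0) sum_ord2 /cofactor !det_mx11 !mxE lift0 lift1 /=.
by ring.
Qed.

Section LiftMatrix.
Variable R : comUnitRingType.
Implicit Types A B : 'M['Z_2]_2.

(* The three nonzero vectors of (Z/2)^2 lift to (1, 0), (0, 1), (-1, -1), which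
   sum to 0 and are permuted by GL_2(Z/2) as the vectors are; this embeds
   GL_2(Z/2) in GL_2(Z), hence maps it to GL_2(R). *)
Definition lift_entry (x y : 'Z_2) : R :=
  if x == 0 then 0 else if y == 0 then 1 else -1.

Definition lift_mx A : 'M[R]_2 :=
  \matrix_(i, j) lift_entry (A i j) (A (rev_ord i) j).

Lemma lift_entryM (a b c d x y : 'Z_2) : a * d - b * c != 0 ->
  lift_entry (a * x + b * y) (c * x + d * y)
    = lift_entry a c * lift_entry x y + lift_entry b d * lift_entry y x.
Proof.
elim/ord2_ind: a; elim/ord2_ind: b; elim/ord2_ind: c; elim/ord2_ind: d;
  rewrite //= => _; elim/ord2_ind: x; elim/ord2_ind: y;
  by rewrite /lift_entry /=; ring.
Qed.

Lemma lift_mxM A B : A \in unitmx -> lift_mx (A *m B) = lift_mx A *m lift_mx B.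
Proof.
rewrite unitmxE det_mx22 => unitA.
have detA : A 0 0 * A 1 1 - A 0 1 * A 1 0 != 0.
  by apply: contraTneq unitA => ->; rewrite unitr0.
have detA_rev : A 1 0 * A 0 1 - A 1 1 * A 0 0 != 0.
  by rewrite -oppr_eq0 opprB mulrC [X in _ - X]mulrC.
have rev0 : rev_ord (0 : 'I_2) = 1 by apply: val_inj.
have rev1 : rev_ord (1 : 'I_2) = 0 by apply: val_inj.
apply/matrixP => i j; rewrite !mxE !sum_ord2 !mxE.
by elim/ord2_ind: i; rewrite !rev0 !rev1; apply: lift_entryM.
Qed.

Lemma lift_mx1 : lift_mx 1%:M = 1%:M.
Proof.
by apply/matrixP => i j; rewrite !mxE; elim/ord2_ind: i; elim/ord2_ind: j.
Qed.

Lemma lift_mx_ker A : lift_mx A = 1%:M -> A = 1%:M.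
Proof.
move=> A1; apply/matrixP => i j.
have := congr1 (fun M : 'M_2 => M i j) A1; rewrite !mxE /lift_entry.
elim/ord2_ind: (A i j) => /=; case: (i == j) => //.
  by move/esym/eqP; rewrite oner_eq0.
by case: ifP => _ /eqP; rewrite ?oppr_eq0 oner_eq0.
Qed.

Lemma lift_mx_unit A : A \in unitmx -> lift_mx A \in unitmx.
Proof.
move=> uA; have := lift_mxM (invmx A) uA.
by rewrite mulmxV // lift_mx1 => /esym/mulmx1_unit[].
Qed.

End LiftMatrix.

Section LiftGL.
Variable R : finComUnitRingType.
Implicit Types x y : {'GL_2['Z_2]}.

Definition lift_GL x : {'GL_2[R]} := FinRing.Unit (lift_mx_unit R (valP x)).

Lemma lift_GL1 : lift_GL 1%g = 1%g.
Proof. by apply: val_inj; apply: lift_mx1. Qed.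

Lemma lift_GLM : {morph lift_GL : x y / (x * y)%g}.
Proof. by move=> x y; apply: val_inj; apply: lift_mxM; apply: valP. Qed.

HB.instance Definition _ :=
  isUMagmaMorphism.Build _ _ lift_GL (lift_GL1, lift_GLM).

Definition lift_GL_morphism : UMagmaMorphism.type {'GL_2['Z_2]} {'GL_2[R]} :=
  lift_GL.

Lemma lift_GL_inj : injective lift_GL_morphism.
Proof.
by apply: gmulf_inj => x /(congr1 val)/lift_mx_ker x1; apply: val_inj.
Qed.

End LiftGL.

(** * The entanglement groups *)

Section EntanglementGroups.
Variables (E : elliptic_curve) (m n : nat) (B : torsion_basis E m).
Hypothesis B_realises : realises_subgroups n B.
Implicit Types G : groupType.

Lemma Ent_trivial_group G : group_iso G 'I_1 -> Ent E m n G.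
Proof.
move=> G1; apply: (Ent_iso _ (B_realises (sub1G (rho_img_group B)))).
apply: group_iso_trans G1 (group_iso_sym (trivial_group_iso _)).
exact: cards1.
Qed.

Lemma Ent_prime_dvd p G :
  prime p -> (p %| #|rho_img B|)%N -> group_iso G 'Z_p -> Ent E m n G.
Proof.
move=> pr_p p_dvd Gp.
have [x im_x ox] := Cauchy (G := rho_img_group B) pr_p p_dvd.
have sub_x : <[x]>%G \subset rho_img B.
  by rewrite (cycle_subG x (rho_img_group B)).
apply: (Ent_iso _ (B_realises sub_x)).
exact: group_iso_trans Gp (group_iso_sym (prime_group_iso pr_p ox)).
Qed.

Lemma Ent_trivial_rho_img G :
  #|rho_img B| = 1%N -> (Ent E m n G <-> group_iso G 'I_1).
Proof.
move=> card_im; split; last exact: Ent_trivial_group.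
case/(Ent_card_dvd B)=> gT [H [GH]].
by rewrite card_im dvdn1 => /eqP/trivial_group_iso; apply: group_iso_trans.
Qed.

Lemma Ent_prime_rho_img p G : prime p -> #|rho_img B| = p ->
  (Ent E m n G <-> group_iso G 'I_1 \/ group_iso G 'Z_p).
Proof.
move=> pr_p card_im; split=> [/(Ent_card_dvd B)[gT [H [GH]]]|[]].
- rewrite card_im => /(primeP pr_p).2/orP[]/eqP cardH; [left | right].
    exact/(group_iso_trans GH)/trivial_group_iso.
  exact/(group_iso_trans GH)/prime_group_iso.
- exact: Ent_trivial_group.
- by apply: Ent_prime_dvd; rewrite ?card_im.
Qed.

End EntanglementGroups.

(* The group T_{2,n} over the field realising the full image has order 6, so it
   can only be S_3. *)
Lemma Ent_surjective_rho (E : elliptic_curve) n (B : torsion_basis E 2)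
    (G : groupType) :
    realises_subgroups n B -> (forall g, exists s, rho B s = g) ->
  Ent E 2 n G <-> S3_subgroup_type G.
Proof.
move=> B_realises rho_onto.
have card_im : #|rho_img B| = 6%N.
  have -> : rho_img B = [set: {'GL_2['Z_2]}].
    by apply/setP => g; rewrite !inE; apply/asboolP.
  by have := @card_GL_2 'F_2; rewrite card_Fp.
split=> [|[G1|G2|G3|GS3]]; first exact: Ent_two_S3_subgroup_type.
- exact: Ent_trivial_group B_realises _ G1.
- by apply: Ent_prime_dvd B_realises _ _ _ _ G2; rewrite ?card_im.
- by apply: Ent_prime_dvd B_realises _ _ _ _ G3; rewrite ?card_im.
have Ent_im := B_realises (rho_img_group B) (subxx _).
apply: (Ent_iso (group_iso_trans GS3 (group_iso_sym _)) Ent_im).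
exact: S3_subgroup_type_card6 card_im (Ent_two_S3_subgroup_type Ent_im).
Qed.

(* Note that 'I_1 is the trivial group, whereas 'Z_1 would be Z/2. *)
Theorem theorem5p1 (q : nat) (q_prime : prime q) (q_odd : odd q)
    (E : elliptic_curve) :
  (forall G : groupType, Ent E 2 q G ->
     [\/ group_iso G 'I_1, group_iso G 'Z_2, group_iso G 'Z_3
       | group_iso G 'S_3])
  /\
  (forall (B2 : torsion_basis E 2) (Bq : torsion_basis E q),
     (forall s : entanglement E 2 q Crat, s = 1%g) ->
     (forall g : {'GL_2['Z_q]}, exists s : fgal Crat, rho Bq s = g) ->
     [/\ (forall g : {'GL_2['Z_2]}, exists s : fgal Crat, rho B2 s = g) ->
           forall G : groupType, Ent E 2 q G <->
             [\/ group_iso G 'I_1, group_iso G 'Z_2, group_iso G 'Z_3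
               | group_iso G 'S_3],
         rho_img B2 \isog [set: 'Z_3] ->
           forall G : groupType, Ent E 2 q G <->
             group_iso G 'I_1 \/ group_iso G 'Z_3,
         rho_img B2 \isog [set: 'Z_2] ->
           forall G : groupType, Ent E 2 q G <->
             group_iso G 'I_1 \/ group_iso G 'Z_2
       & (forall s : fgal Crat, rho B2 s = 1%g) ->
           forall G : groupType, Ent E 2 q G <-> group_iso G 'I_1]).
Proof.
split=> [G|B2 Bq triv_ent rhoq_onto]; first exact: Ent_two_S3_subgroup_type.
have B2_realises := realises_subgroups_of_disjoint
  (Bm := B2) (@lift_GL_inj _) triv_ent rhoq_onto.
split.
- by move=> rho2_onto G; apply: Ent_surjective_rho B2_realises rho2_onto.
- move=> /card_isog im3 G; apply: (Ent_prime_rho_img B2_realises) => //.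
  by rewrite [LHS]im3 cardsT card_ord.
- move=> /card_isog im2 G; apply: (Ent_prime_rho_img B2_realises) => //.
  by rewrite [LHS]im2 cardsT card_ord.
- move=> rho2_triv G; apply: (Ent_trivial_rho_img B2_realises).
  suff -> : rho_img B2 = 1%g by rewrite cards1.
  apply/trivgP/subsetP => g; rewrite inE => /asboolP[s <-].
  exact/set1P/rho2_triv.
Qed.
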